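(* Let $\mathbb{K}$ be a field. If $G$ is a co-chordal-cactus graph without isolated vertices, or a co-grid graph, then the edge ideal $I_1(G)$ satisfies $\operatorname{reg}(I_1(G))\le 3$.
   Context: All graphs are finite and simple; $\overline{G}$ denotes the complement of $G$. For a graph $G$, $I_1(G)$ is the edge ideal, generated by the monomials $xy$ for $\{x,y\}\in E(G)$ in the polynomial ring over $\mathbb{K}$ whose variables are the vertices of $G$. For a homogeneous ideal $I$ with graded Betti numbers $\beta_{i,j}(I)$, the Castelnuovo--Mumford regularity is $\operatorname{reg}(I)=\max\{j-i:\beta_{i,j}(I)\ne0\}$ (the bound is vacuous for the zero ideal). A graph is chordal if it has no induced cycle of length at least $4$. A cactus graph is a graph (not necessarily connected) in which every edge lies in at most one cycle. $G$ is a co-chordal-cactus graph if $\overline{G}$ admits a representation $(T,\{H_e\}_{e\in E(T)})$ such that: (i) $T$ is a cactus graph (the skeleton of $\overline{G}$); (ii) for each $e\in E(T)$, $H_e$ is an induced subgraph of $\overline{G}$ and is either a cycle of length $\ge 3$ or a chordal graph; (iii) $V(\overline{G})=\bigcup_{e\in E(T)}V(H_e)$ and $E(\overline{G})=\bigcup_{e\in E(T)}E(H_e)$; (iv) for any distinct $e,f\in E(T)$, $|V(H_e)\cap V(H_f)|\le 1$, and the intersection is nonempty only when $e$ and $f$ share a common endpoint in $T$. The grid graph $G_{n,m}=P_n\square P_m$ has vertex set $\{x_{i,j}: 1\le i\le n, 1\le j\le m\}$, with $x_{i,j}$ and $x_{k,\ell}$ adjacent iff $|i-k|+|j-\ell|=1$;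 a co-grid graph is the complement of a grid graph.
   Formalization: Condition (iv) is strengthened: each v in V(T) is assigned one vertex of the complement, and H_e, H_f may meet only at the vertex assigned to a common endpoint of e and f; read literally the claim fails for G = 3K_2 (T = K_{1,12}, H_e the edges of the octahedron, reg = 4). *)

(* Defs.v *)
From HB Require Import structures.
From mathcomp Require Import all_boot all_order all_algebra.
From mathcomp Require Export mpoly.

Set Implicit Arguments.
Unset Strict Implicit.
Unset Printing Implicit Defensive.

Import GRing.Theory Num.Theory.
Local Open Scope ring_scope.

(** * Finite simple graphs *)

Record sgraph := SGraph {
  vertex :> finType;
  adj : rel vertex;
  adj_sym : ssrbool.symmetric adj;
  adj_irrefl : irreflexive adj }.

Definition edges (G : sgraph) : {set {set G}} :=
  [set [set p.1; p.2] | p in [pred p : G * G | adj p.1 p.2]].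

Section Complement.
Variable G : sgraph.
Definition compl_adj : rel G := [rel x y | (x != y) && ~~ adj x y].
Lemma compl_sym : ssrbool.symmetric compl_adj.
Proof. by move=> x y; rewrite /compl_adj /= eq_sym adj_sym. Qed.
Lemma compl_irrefl : irreflexive compl_adj.
Proof. by move=> x; rewrite /compl_adj /= eqxx. Qed.
Definition compl : sgraph := SGraph compl_sym compl_irrefl.
End Complement.

Section Induced.
Variables (G : sgraph) (W : {set G}).
Definition induced_adj : rel {x : G | x \in W} :=
  [rel x y | adj (val x) (val y)].
Lemma induced_sym : ssrbool.symmetric induced_adj.
Proof. by move=> x y; rewrite /induced_adj /= adj_sym. Qed.
Lemma induced_irrefl : irreflexive induced_adj.
Proof. by move=> x; rewrite /induced_adj /= adj_irrefl. Qed.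
Definition induced : sgraph := SGraph induced_sym induced_irrefl.
End Induced.

Definition isomorphic (G H : sgraph) : Prop :=
  exists2 f : G -> H, bijective f & forall x y, adj (f x) (f y) = adj x y.

Definition no_isolated_vertex (G : sgraph) : Prop :=
  forall x : G, exists y : G, adj x y.

(** [graph_cycle c]: the sequence [c] traverses a cycle of [G]; two such
    sequences describe the same cycle iff they have the same [cycle_edges]. *)
Definition graph_cycle (G : sgraph) (c : seq G) : Prop :=
  ucycle (@adj G) c /\ (3 <= size c)%N.

Definition cycle_edges (G : sgraph) (c : seq G) : {set {set G}} :=
  [set [set x; next c x] | x in c].

Definition is_cycle_graph (G : sgraph) : Prop :=
  exists c : seq G,
    [/\ graph_cycle c, forall x, x \in c & edges G = cycle_edges c].

Definition chordal (G : sgraph) : Prop :=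
  forall W : {set G}, is_cycle_graph (induced W) -> (#|W| < 4)%N.

Definition cactus (G : sgraph) : Prop :=
  forall (c1 c2 : seq G) (e : {set G}), graph_cycle c1 -> graph_cycle c2 ->
    e \in cycle_edges c1 -> e \in cycle_edges c2 ->
    cycle_edges c1 = cycle_edges c2.

(** * Chordal-cactus representations *)

(** [W e] is the vertex set of [H_e], so [H_e] is [induced (W e)].
    [att v] is the vertex of [H] at which the pieces attached to edges of the
    skeleton incident to [v] may be glued: two pieces [H_e] and [H_f] can only
    meet at the vertex corresponding to a common endpoint of [e] and [f].
    If the position of the common vertex were not tied to the common endpoint,
    a star with one edge per edge and per isolated vertex of [H] would be a
    skeleton of an arbitrary graph [H]. *)
Record chordal_cactus_rep (H T : sgraph)
    (W : {set T} -> {set H}) (att : T -> H) : Prop := ChordalCactusRep {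
  rep_skeleton : cactus T;
  rep_piece : forall e, e \in edges T ->
    is_cycle_graph (induced (W e)) \/ chordal (induced (W e));
  rep_vertices : [set: H] = \bigcup_(e in edges T) W e;
  rep_edges : edges H =
    \bigcup_(e in edges T) [set h in edges H | h \subset W e];
  rep_meet : forall e f, e \in edges T -> f \in edges T -> e != f ->
    (#|W e :&: W f| <= 1)%N;
  rep_glue : forall e f, e \in edges T -> f \in edges T -> e != f ->
    forall x, x \in W e :&: W f -> exists2 v, v \in e :&: f & x = att v }.

Definition co_chordal_cactus (G : sgraph) : Prop :=
  exists (T : sgraph) (W : {set T} -> {set compl G}) (att : T -> compl G),
    chordal_cactus_rep W att.

(** * Grid graphs *)

Section Grid.
Variables n m : nat.
Local Open Scope nat_scope.
Definition dist (a b : nat) : nat := (a - b) + (b - a).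
Definition grid_adj : rel ('I_n * 'I_m) :=
  [rel x y : 'I_n * 'I_m | dist x.1 y.1 + dist x.2 y.2 == 1].
Lemma grid_sym : ssrbool.symmetric grid_adj.
Proof.
by move=> x y; rewrite /grid_adj /= /dist [(x.1 - _) + _]addnC [(x.2 - _) + _]addnC.
Qed.
Lemma grid_irrefl : irreflexive grid_adj.
Proof. by move=> x; rewrite /grid_adj /= /dist !subnn. Qed.
Definition grid : sgraph := SGraph grid_sym grid_irrefl.
End Grid.

Definition co_grid (G : sgraph) : Prop :=
  exists n m : nat,
    [/\ (0 < n)%N, (0 < m)%N & isomorphic G (compl (grid n m))].

(** * Edge ideals and graded Betti numbers *)

(** Ideals are given by their membership predicates. *)
Definition edge_ideal (K : fieldType) (G : sgraph) (p : {mpoly K[#|G|]}) : Prop :=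
  exists c : G * G -> {mpoly K[#|G|]},
    p = \sum_(xy : G * G | adj xy.1 xy.2)
          c xy * ('X_(enum_rank xy.1) * 'X_(enum_rank xy.2)).
Arguments edge_ideal : clear implicits.

Section Betti.
Variables (K : fieldType) (n : nat).
Local Notation S := {mpoly K[n]}.

(** The entry of the matrix of a degree-preserving map which sends a basis
    element of degree [s] to a multiple of a basis element of degree [t]. *)
Definition graded_entry (s t : nat) (p : S) : Prop :=
  p = 0 \/ (t <= s)%N /\ p \is (s - t).-homog.

(** A complex [... -> F_1 -> F_0 -> S] of graded free modules of finite rank.
    Maps are matrices acting on row vectors from the right, and
    [F_i = \bigoplus_k S(- shift i k)].  Natural numbers are enough for the
    shifts, as the minimal generators of a submodule of [S^r], with [S^r]
    generated in nonnegative degrees, have nonnegative degrees. *)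
Record graded_free_complex := GradedFreeComplex {
  rk : nat -> nat;
  shift : forall i, 'I_(rk i) -> nat;
  diff : forall i, 'M[S]_(rk i.+1, rk i);
  aug : 'cV[S]_(rk 0);
  diff_graded : forall i a b,
    graded_entry (shift a) (shift b) (diff i a b);
  aug_graded : forall a, graded_entry (shift a) 0 (aug a 0) }.

Record minimal_resolution (I : S -> Prop) (F : graded_free_complex) : Prop :=
  MinimalResolution {
    res_image : forall p, I p <-> exists v : 'rV[S]_(rk F 0), p = (v *m aug F) 0 0;
    res_exact0 : forall v : 'rV[S]_(rk F 0),
      v *m aug F = 0 <-> exists w, v = w *m diff F 0;
    res_exactS : forall i (v : 'rV[S]_(rk F i.+1)),
      v *m diff F i = 0 <-> exists w, v = w *m diff F i.+1;
    res_minimal : forall i a b, (diff F i a b)@_0%MM = 0 }.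

(** [graded_betti I i j b]: the graded Betti number [beta_(i,j)(I)] is [b]. *)
Definition graded_betti (I : S -> Prop) (i j b : nat) : Prop :=
  exists2 F : graded_free_complex, minimal_resolution I F &
    #|[set k : 'I_(rk F i) | shift k == j]| = b.

(** [reg(I) <= r], where [reg(I) = max {j - i : beta_(i,j)(I) != 0}]. *)
Definition reg_le (I : S -> Prop) (r : int) : Prop :=
  forall i j b : nat, graded_betti I i j b -> b <> 0%N -> j%:Z - i%:Z <= r.
End Betti.

(* Main.v *)
Require Import Defs.
From mathcomp Require Import all_boot all_order all_algebra.
From mathcomp Require Import zify ring.

Set Implicit Arguments.
Unset Strict Implicit.
Unset Printing Implicit Defensive.

Import GRing.Theory.
Local Open Scope ring_scope.

(** Let [H] be the complement of [G] and [S] the polynomial ring.  A monomial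
    lies in the edge ideal of [G] iff its support is not a clique of [H], so
    that the ideal is the Stanley-Reisner ideal of the clique complex of [H].
    For a set [W] of vertices let [J(W)] be the ideal of the clique complex of
    [H[W]], together with the variables outside [W].  For [x] in [W],
      [(J(W), x) = J(W \ x)]  and  [J(W) : x = J(W cap N[x])],
    and [x] is a nonzerodivisor modulo the second ideal, where adding it gives
    [J(W cap N(x))].  Hence
      [reg S/J(W) <= max (reg S/J(W \ x), 1 + reg S/J(W cap N(x)))]
    ([reg_step]).  Removing vertices one at a time, this gives regularity [0]
    if [W] is a clique, [1] if [H[W]] can be emptied by removing simplicial
    vertices, and [2] if every neighbourhood in [H] can be so emptied
    ([reg_locally_simplicial]).  As [reg I = reg S/I + 1], it is enough that
    the neighbourhoods of [H] have simplicial elimination orders.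

    In a grid there are no triangles, so neighbourhoods are independent sets.
    In a chordal-cactus graph, the neighbourhood of [v] is made of its
    neighbourhoods in the pieces through [v]; these are chordal, or have at
    most two vertices.  An edge between two of these parts closes a triangle
    that meets three pieces, hence comes from a triangle of the skeleton, and
    an edge of a cactus lies in at most one triangle.  So a part is left by at
    most one edge ([bridge_unique]), and by Dirac's theorem a chordal graph
    has simplicial vertices outside any prescribed vertex, here the end of
    that edge ([chordal_cactus_link]).

    The regularity above is read off Koszul homology ([koszul_reg]), where
    both exact sequences become manipulations of cycles.  A diagram chase
    between the Koszul complex and a minimal resolution carries a basis
    element of the resolution to a Koszul cycle modulo the ideal.  If the
    degree of the basis element were too large this cycle would bound, and the
    basis element would lie in the maximal ideal times the module, which is
    absurd ([lift_boundary], [shift_le]). *)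

(** * Polynomials supported on a set of monomials *)

Section Supports.
Variables (K : fieldType) (n : nat).
Local Notation S := {mpoly K[n]}.
Implicit Types (U V A B C : pred 'X_{1..n}) (p q : S) (m : 'X_{1..n}).

(** For a monomial ideal with set of monomials [U], this is membership. *)
Definition supported U p := forall m, m \in msupp p -> U m.

Definition monomial_ideal U := forall m m', U m -> U (m + m')%MM.

Definition var_ideal (i : 'I_n) : pred 'X_{1..n} := fun m => m i != 0%N.
Definition idealU U V : pred 'X_{1..n} := fun m => U m || V m.
Definition colon U (i : 'I_n) : pred 'X_{1..n} := fun m => U (m + U_(i))%MM.
Definition deg_ge (k : nat) : pred 'X_{1..n} := fun m => (k <= mdeg m)%N.

Lemma supported0 U : supported U 0.
Proof. by move=> m; rewrite msupp0. Qed.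

Lemma supportedW U V p :
  (forall m, U m -> V m) -> supported U p -> supported V p.
Proof. by move=> UV Up m /Up /UV. Qed.

Lemma supportedT p : supported predT p.
Proof. by []. Qed.

Lemma supportedD U p q : supported U p -> supported U q -> supported U (p + q).
Proof. by move=> Up Uq m /msuppD_le; rewrite mem_cat => /orP[/Up|/Uq]. Qed.

Lemma supportedN U p : supported U p -> supported U (- p).
Proof. by move=> Up m; rewrite (perm_mem (msuppN p)) => /Up. Qed.

Lemma supportedB U p q : supported U p -> supported U q -> supported U (p - q).
Proof. by move=> Up Uq; apply: supportedD => //; apply: supportedN. Qed.

Lemma supported_sum U (I : Type) (r : seq I) (P : pred I) (F : I -> S) :
  (forall i, P i -> supported U (F i)) -> supported U (\sum_(i <- r | P i) F i).
Proof.
move=> h; apply: (big_ind (supported U)) => //; first exact: supported0.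
by move=> p q; apply: supportedD.
Qed.

Lemma supported_mul A B C p q :
  (forall m m', A m -> B m' -> C (m + m')%MM) ->
  supported A p -> supported B q -> supported C (p * q).
Proof.
move=> h Ap Bq m /msuppM_le /allpairsP[[m1 m2] /= [/Ap h1 /Bq h2 ->]].
exact: h.
Qed.

Lemma supported_mull U p q :
  monomial_ideal U -> supported U q -> supported U (p * q).
Proof.
move=> idU; apply: supported_mul (@supportedT p) => m m' _ h.
by rewrite addmC; apply: idU.
Qed.

Lemma supported_scaleX U (c : K) m : U m -> supported U (c *: 'X_[m]).
Proof. by move=> Um m' /msuppZ_le; rewrite msuppX inE => /eqP ->. Qed.

Lemma supportedX i : supported (pred1 U_(i)%MM) ('X_i : S).
Proof. by move=> m; rewrite msuppX inE. Qed.

Lemma supported_colon U i p : supported U ('X_i * p) -> supported (colon U i) p.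
Proof.
move=> Up m; rewrite mcoeff_msupp -(mcoeffMX p U_(i) m) mulrC -mcoeff_msupp.
by rewrite addmC; apply: Up.
Qed.

(** The quotient of [p] by ['X_i] which leaves a remainder free of ['X_i].  The
    two lemmas below say that this division respects monomial ideals. *)
Definition divX (i : 'I_n) p : S :=
  \sum_(m <- msupp p | m i != 0%N) p@_m *: 'X_[m - U_(i)].

Lemma supported_divX i U p : supported U p -> supported (colon U i) (divX i p).
Proof.
move=> Up; rewrite /divX big_seq_cond; apply: supported_sum => m /andP[mp mi].
by apply: supported_scaleX; rewrite /colon submK ?lep1mP //; apply: Up.
Qed.

Lemma supported_modX i U p :
  supported U p ->
  supported (predI U (fun m => m i == 0%N)) (p - 'X_i * divX i p).
Proof.
move=> Up; suff -> : p - 'X_i * divX i p =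
  \sum_(m <- msupp p | m i == 0%N) p@_m *: 'X_[m].
  rewrite big_seq_cond; apply: supported_sum => m /andP[mp mi].
  by apply: supported_scaleX; rewrite /= mi Up.
rewrite {1}(mpolyE p) (bigID (fun m : 'X_{1..n} => m i != 0%N)) /= mulr_sumr.
rewrite addrAC -sumrB big1 ?add0r; first by apply: eq_bigl => m; rewrite negbK.
by move=> m mi; rewrite -scalerAr -mpolyXD addmC submK ?subrr ?lep1mP.
Qed.

End Supports.

(** * The Koszul complex *)

Section Koszul.
Variables (K : fieldType) (n : nat).
Local Notation S := {mpoly K[n]}.
Implicit Types (w u : {set 'I_n} -> S) (B : {set 'I_n}) (a x : 'I_n).

Definition ksgn a B : S := (-1) ^+ #|[set b in B | (b < a)%N]|.

(** A chain of the Koszul complex on the variables is given by its coefficients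
    on the exterior basis, indexed by sets of variables; [kd w B] collects the
    contributions of all [a |: B] to the coefficient at [B]. *)
Definition kd w B : S := \sum_(a | a \notin B) ksgn a B * 'X_a * w (a |: B).

Definition wedge x w B : S :=
  if x \in B then ksgn x (B :\ x) * w (B :\ x) else 0.

Lemma ksgnU x a B : x \notin B ->
  ksgn a (x |: B) = (if (x < a)%N then -1 else 1) * ksgn a B.
Proof.
move=> xB; rewrite /ksgn; case: ifP => xa.
  have -> : [set b in x |: B | (b < a)%N] = x |: [set b in B | (b < a)%N].
    by apply/setP=> b; rewrite !inE; case: eqVneq => [->|].
  by rewrite cardsU1 !inE (negbTE xB) /= exprS.
rewrite mul1r; congr (_ ^+ #|pred_of_set _|); apply/setP=> b; rewrite !inE.
by case: eqVneq => [->|//]; rewrite xa (negbTE xB).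
Qed.

Lemma ksgnK a B : ksgn a B * ksgn a B = 1.
Proof. by rewrite -expr2 sqrr_sign. Qed.

Lemma ksgn_swap a x B : a != x -> a \notin B -> x \notin B ->
  ksgn a (x |: B) * ksgn x (a |: B) = - (ksgn a B * ksgn x B).
Proof.
move=> ax aB xB; rewrite !ksgnU //; have: nat_of_ord a != x by [].
by case: ltngtP => // _ _; ring.
Qed.

Lemma ksgn_anticomm a x B : a != x -> a \notin B -> x \notin B ->
  ksgn a B * ksgn x (a |: B) = - (ksgn x B * ksgn a (x |: B)).
Proof.
move=> ax aB xB; rewrite !ksgnU //; have: nat_of_ord a != x by [].
by case: ltngtP => // _ _; ring.
Qed.

Lemma eq_kd w u B : (forall A, w A = u A) -> kd w B = kd u B.
Proof. by move=> h; apply: eq_bigr => a _; rewrite h. Qed.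

Lemma kdB w u B : kd (fun A => w A - u A) B = kd w B - kd u B.
Proof. by rewrite /kd -sumrB; apply: eq_bigr => a _; rewrite mulrBr. Qed.

Lemma kdD w u B : kd (fun A => w A + u A) B = kd w B + kd u B.
Proof. by rewrite /kd -big_split; apply: eq_bigr => a _; rewrite /= mulrDr. Qed.

Lemma kdMl (c : S) w B : kd (fun A => c * w A) B = c * kd w B.
Proof. by rewrite /kd mulr_sumr; apply: eq_bigr => a _; rewrite mulrCA. Qed.

Lemma kd_kd w B : kd (kd w) B = 0.
Proof.
pose F a c := ksgn a B * 'X_a * (ksgn c (a |: B) * 'X_c * w (c |: (a |: B))).
pose P a c := [&& a \notin B, c \notin B & c != a].
have -> : kd (kd w) B = \sum_a \sum_(c | P a c) F a c.
  rewrite /kd big_mkcond; apply: eq_bigr => a _; case: ifPn => aB; last first.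
    by rewrite big_pred0 // => c; rewrite /P (negbTE aB).
  rewrite mulr_sumr; apply: eq_bigl => c.
  by rewrite /P aB !inE negb_or andbC.
have FN a c : P a c -> F a c = - F c a.
  case/and3P=> aB cB ca; rewrite /F setUCA.
  have -> : ksgn a B * 'X_a * (ksgn c (a |: B) * 'X_c * w (a |: (c |: B)))
     = (ksgn a B * ksgn c (a |: B)) * ('X_a * 'X_c * w (a |: (c |: B))) by ring.
  by rewrite ksgn_anticomm 1?eq_sym //; ring.
(* Pairing the terms with [a < c] and [c < a] avoids dividing by 2. *)
transitivity (\sum_a \sum_(c | P a c && (a < c)%N) F a c
             + \sum_a \sum_(c | P a c && (c < a)%N) F a c).
  rewrite -big_split; apply: eq_bigr => a _ /=.
  rewrite (bigID (fun c : 'I_n => (a < c)%N)) /=; congr (_ + _).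
  apply: eq_bigl => c; rewrite -leqNgt leq_eqVlt /P.
  by rewrite -(inj_eq val_inj) /=; case: ltngtP; rewrite ?andbF ?andbT.
rewrite [X in _ + X](exchange_big_dep xpredT) //= -big_split big1 // => a _ /=.
apply/eqP; rewrite addr_eq0 -sumrN; apply/eqP.
have PC c : P a c = P c a by rewrite /P andbCA eq_sym.
by apply: eq_big => [c|c /andP[h _]]; rewrite ?PC // FN // .
Qed.

(** The homotopy formula: each variable acts as zero on Koszul homology. *)
Lemma kd_wedge x w B : kd (wedge x w) B + wedge x (kd w) B = 'X_x * w B.
Proof.
have [xB|xB] := boolP (x \in B).
  have [C xC ->] : exists2 C : {set 'I_n}, x \notin C & B = x |: C.
    by exists (B :\ x); rewrite ?setD11 ?setD1K.
  rewrite {2}/wedge setU11 setU1K // /kd.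
  rewrite (bigD1 x (P := fun a => a \notin C)) //=.
  rewrite mulrDr !mulrA ksgnK mul1r addrCA mulr_sumr.
  suff -> : \sum_(a | a \notin x |: C)
      ksgn a (x |: C) * 'X_a * wedge x w (a |: (x |: C)) =
    - \sum_(i < n | (i \notin C) && (i != x))
       ksgn x C * (ksgn i C * 'X_i * w (i |: C)) by rewrite addNr addr0.
  rewrite -sumrN; apply: eq_big => [a|a].
    by rewrite !inE negb_or andbC.
  rewrite !inE negb_or => /andP[ax aC]; rewrite /wedge setUCA setU11.
  rewrite setU1K; last by rewrite !inE negb_or eq_sym ax.
  have -> : ksgn a (x |: C) * 'X_a * (ksgn x (a |: C) * w (a |: C)) =
     (ksgn a (x |: C) * ksgn x (a |: C)) * ('X_a * w (a |: C)) by ring.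
  by rewrite ksgn_swap //; ring.
rewrite {2}/wedge (negbTE xB) addr0 /kd (bigD1 x) //= big1 ?addr0.
  by rewrite /wedge setU11 setU1K // mulrACA ksgnK mul1r.
move=> a /andP[aB ax]; rewrite /wedge !inE (negbTE xB) orbF eq_sym.
by rewrite (negbTE ax) mulr0.
Qed.

Definition level (p : nat) w := forall B, #|B| != p -> w B = 0.

Lemma level_kd p w : level p.+1 w -> level p (kd w).
Proof.
move=> h B Bp; apply: big1 => a aB; rewrite h ?mulr0 //.
by rewrite cardsU1 aB add1n eqSS.
Qed.

Lemma level_wedge p x w : level p w -> level p.+1 (wedge x w).
Proof.
move=> h B Bp; rewrite /wedge; case: ifP => // xB; rewrite h ?mulr0 //.
by move: Bp; rewrite (cardsD1 x) xB add1n eqSS.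
Qed.

Lemma supported_ksgnM U a B p : supported U p -> supported U (ksgn a B * p).
Proof.
move=> Up; rewrite /ksgn -signr_odd mulr_sign; case: ifP => // _.
exact: supportedN.
Qed.

Lemma supported_kd (U V : pred 'X_{1..n}) w B :
  (forall a m, U m -> V (U_(a) + m)%MM) ->
  (forall A, supported U (w A)) -> supported V (kd w B).
Proof.
move=> UV Uw; apply: supported_sum => a _; rewrite -mulrA.
apply/supported_ksgnM; apply: supported_mul (Uw _); last exact: supportedX.
by move=> m m' /eqP -> /UV.
Qed.

Lemma supported_wedge U x w B :
  (forall A, supported U (w A)) -> supported U (wedge x w B).
Proof.
move=> Uw; rewrite /wedge; case: ifP => _; last exact: supported0.
exact/supported_ksgnM.
Qed.

End Koszul.

(** * Regularity through Koszul homology *)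

Section Regularity.
Variables (K : fieldType) (n : nat).
Local Notation S := {mpoly K[n]}.
Implicit Types (U : pred 'X_{1..n}) (x : 'I_n) (k : nat).

(** The regularity of the quotient by [U] is at most [k]: Koszul cycles with
    coefficients in degrees above [k] are boundaries.  Asking for all
    [k' >= k], and for a control of the degree of the bounding chain, lets the
    bound pass through the inductions without homogeneous components. *)
Definition koszul_reg U k := forall k' p (w : {set 'I_n} -> S),
  (k <= k')%N -> level p w -> (forall A, supported (deg_ge k'.+1) (w A)) ->
  (forall A, supported U (kd w A)) ->
  exists u, [/\ level p.+1 u, forall A, supported (deg_ge k') (u A)
              & forall A, supported U (w A - kd u A)].

Lemma koszul_reg_ext U V k :
  (forall m, U m = V m) -> koszul_reg U k -> koszul_reg V k.
Proof.
move=> UV h k' p w kk lw dw zw.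
have [A|u [lu du eu]] := h k' p w kk lw dw; last first.
  by exists u; split=> // A; apply: supportedW (eu A) => m; rewrite UV.
by apply: supportedW (zw A) => m; rewrite UV.
Qed.

(** The part common to the two exact sequences: a cycle modulo [U] that bounds
    modulo [U] and ['X_x] is, up to a boundary and modulo [U], the product of
    ['X_x] with a cycle modulo the colon ideal. *)
Lemma reg_split U x k k' p (w : {set 'I_n} -> S) : monomial_ideal U ->
  koszul_reg (idealU U (var_ideal x)) k -> (k <= k')%N -> level p w ->
  (forall A, supported (deg_ge k'.+1) (w A)) ->
  (forall A, supported U (kd w A)) ->
  exists u q, [/\ level p.+1 u, forall A, supported (deg_ge k') (u A)
    & [/\ level p q, forall A, supported (deg_ge k') (q A),
         forall A, supported (colon U x) (kd q A)
       & forall A, supported U (w A - kd u A - 'X_x * q A)]].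
Proof.
move=> idU regU kk lw dw zw.
have [A|u [lu du eu]] := regU k' p w kk lw dw.
  by apply: supportedW (zw A) => m Um; rewrite /idealU Um.
pose r A := w A - kd u A; pose q A := divX x (r A).
have sq A : supported U (r A - 'X_x * q A).
  apply: supportedW (supported_modX (eu A)) => m /= /andP[].
  by rewrite /idealU /var_ideal; case: eqP => //; rewrite orbF.
exists u, q; split=> //; split=> // A.
- move=> Ap; rewrite /q /r lw // (level_kd lu) // subrr /divX.
  by rewrite -mpolyC0 msupp0 big_nil.
- have : supported (deg_ge k'.+1) (r A).
    apply: supportedB => //; apply: supported_kd du => a m.
    by rewrite /deg_ge mdegD mdeg1.
  move/(supported_divX (i := x)); apply: supportedW => m.
  by rewrite /colon /deg_ge mdegD mdeg1 addn1.
- apply: supported_colon.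
  have -> : 'X_x * kd q A = kd w A - kd (fun A => r A - 'X_x * q A) A.
    by rewrite !kdB kdMl kd_kd subr0 subKr.
  apply: supportedB => //; apply: supported_kd sq => a m Um.
  by rewrite addmC; apply: idU.
Qed.

(** The long exact homology sequence of
    [0 -> S/(U : x)(-1) -> S/U -> S/(U, x) -> 0]. *)
Lemma koszul_reg_step U x k : monomial_ideal U ->
  koszul_reg (idealU U (var_ideal x)) k.+1 -> koszul_reg (colon U x) k ->
  koszul_reg U k.+1.
Proof.
move=> idU regV regC [//|k'] p w kk lw dw zw.
have [u [q [lu du [lq dq zq eq]]]] := reg_split idU regV kk lw dw zw.
have [v [lv dv ev]] := regC k' p q kk lq dq zq.
exists (fun A => u A + 'X_x * v A); split=> A.
- by move=> Ap; rewrite lu // lv // mulr0 addr0.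
- apply: supportedD => //; apply: supported_mul (@supportedX _ _ x) (dv A).
  by move=> m m' /eqP ->; rewrite /deg_ge mdegD mdeg1.
- rewrite kdD kdMl.
  have -> : w A - (kd u A + 'X_x * kd v A) =
    (w A - kd u A - 'X_x * q A) + 'X_x * (q A - kd v A) by ring.
  apply: supportedD => //; apply: supported_mul (@supportedX _ _ x) (ev A).
  by move=> m m' /eqP -> ; rewrite addmC.
Qed.

(** If [x] is a nonzerodivisor modulo [U], then multiplication by [x] is zero on
    Koszul homology, so that the homology of [S/U] embeds in that of
    [S/(U, x)]. *)
Lemma koszul_reg_cone U x k : monomial_ideal U ->
  (forall m, colon U x m -> U m) ->
  koszul_reg (idealU U (var_ideal x)) k -> koszul_reg U k.
Proof.
move=> idU nzx regV k' p w kk lw dw zw.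
have [u [q [lu du [lq dq zq eq]]]] := reg_split idU regV kk lw dw zw.
exists (fun A => u A + wedge x q A); split=> A.
- by move=> Ap; rewrite lu // (level_wedge x lq) // addr0.
- by apply: supportedD => //; apply: supported_wedge.
- rewrite kdD.
  have -> : w A - (kd u A + kd (wedge x q) A) =
    (w A - kd u A - 'X_x * q A) + wedge x (kd q) A.
    by rewrite -(kd_wedge x q A); ring.
  apply: supportedD => //; apply: supportedW nzx _.
  exact: supported_wedge.
Qed.

End Regularity.

(** * Clique complexes *)

Section CliqueComplex.
Variables (K : fieldType) (H : sgraph).
Implicit Types (W A : {set H}) (x y : H) (m : 'X_{1..#|H|}).

Lemma adj_neq x y : adj x y -> x != y.
Proof. by move=> xy; apply: contraTneq xy => ->; rewrite adj_irrefl. Qed.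

Definition nbhd x : {set H} := [set y | adj x y].

Definition clique A := [forall x in A, forall y in A, (x != y) ==> adj x y].

Lemma cliqueP A :
  reflect {in A &, forall x y, x != y -> adj x y} (clique A).
Proof.
apply: (iffP forall_inP) => [h x y xA yA xy|h x xA].
  by move/forall_inP/(_ y yA): (h x xA); rewrite xy.
by apply/forall_inP=> y yA; apply/implyP; apply: h.
Qed.

Lemma cliqueS A W : A \subset W -> clique W -> clique A.
Proof.
move=> /subsetP AW /cliqueP cW; apply/cliqueP=> x y xA yA.
by apply: cW; apply: AW.
Qed.

Definition msupport m : {set H} := [set x | m (enum_rank x) != 0%N].

(** The monomials of the Stanley-Reisner ideal of the clique complex of the
    subgraph induced on [W], with the variables outside [W] added. *)
Definition nonface W : pred 'X_{1..#|H|} :=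
  fun m => ~~ ((msupport m \subset W) && clique (msupport m)).

Lemma msupportD m m' : msupport (m + m')%MM = msupport m :|: msupport m'.
Proof. by apply/setP=> x; rewrite !inE mnmDE addn_eq0 negb_and. Qed.

Lemma msupport1 x : msupport U_(enum_rank x)%MM = [set x].
Proof.
apply/setP=> y; rewrite !inE mnm1E (inj_eq enum_rank_inj) [x == y]eq_sym.
by case: (y == x).
Qed.

Lemma nonface_ideal W : monomial_ideal (nonface W).
Proof.
move=> m m'; apply: contra => /andP[]; rewrite msupportD => sW cW.
by rewrite (subset_trans (subsetUl _ _) sW) (cliqueS (subsetUl _ _) cW).
Qed.

Lemma nonface_var W x m :
  idealU (nonface W) (var_ideal (enum_rank x)) m = nonface (W :\ x) m.
Proof.
rewrite /idealU /nonface subsetD1 /var_ideal inE.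
by case: (_ \subset _); case: (_ == _); case: (clique _).
Qed.

Lemma nonface_colon W x m : x \in W ->
  colon (nonface W) (enum_rank x) m = nonface (W :&: (x |: nbhd x)) m.
Proof.
move=> xW; rewrite /colon /nonface msupportD msupport1; congr (~~ _).
apply/andP/andP=> [[sW cW]|[sW cW]]; last first.
  split.
    by rewrite subUset sub1set xW andbT (subset_trans sW) // subsetIl.
  move: sW; rewrite subsetI => /andP[_ /subsetP sN].
  have adjx y : y \in msupport m -> y != x -> adj x y.
    by move=> /sN; rewrite !inE => /orP[->|].
  apply/cliqueP=> y z; rewrite ![_ \in _ :|: _]in_setU !in_set1.
  case/orP=> [ym|/eqP ->] /orP[zm|/eqP ->] yz.
  - exact: (cliqueP _ cW).
  - by rewrite adj_sym adjx.
  - by rewrite adjx // eq_sym.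
  - by rewrite eqxx in yz.
split; last exact: cliqueS (subsetUl _ _) cW.
rewrite subsetI (subset_trans (subsetUl _ _) sW) /=.
apply/subsetP=> y ym; rewrite !inE; case: eqVneq => //= yx.
by apply: (cliqueP _ cW); rewrite ?in_setU ?in_set1 ?ym ?eqxx ?orbT // eq_sym.
Qed.

Local Notation reg := (@koszul_reg K #|H|).

(** The ideal of the complex without vertices is the maximal ideal, which
    contains every chain with coefficients of positive degree. *)
Lemma reg_nonface0 k : reg (nonface set0) k.
Proof.
move=> k' p w _ _ dw _; exists (fun=> 0); split=> // [A|A].
  exact: supported0.
rewrite /kd big1 => [|a _]; last by rewrite mulr0.
rewrite subr0; apply: supportedW (dw A) => m mdg; apply/negP=> /andP[].
rewrite subset0 => /eqP m0 _; move: mdg; rewrite /deg_ge.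
suff -> : m = 0%MM by rewrite mdeg0.
apply/mnmP=> i; rewrite mnm0E; move/setP/(_ (enum_val i)): m0.
by rewrite !inE enum_valK => /negbFE/eqP.
Qed.

(** If [x] is joined to the rest of [W], the clique complex is a cone with
    apex [x], and ['X_x] is a nonzerodivisor modulo its ideal. *)
Lemma reg_cone W x k : x \in W -> W :\ x \subset nbhd x ->
  reg (nonface (W :\ x)) k -> reg (nonface W) k.
Proof.
move=> xW Wx h; apply: (koszul_reg_cone (x := enum_rank x)).
- exact: nonface_ideal.
- move=> m; rewrite nonface_colon // (_ : W :&: _ = W) //.
  by apply/setIidPl; rewrite -(setD1K xW) setUS.
- by apply: koszul_reg_ext h => m; rewrite nonface_var.
Qed.

(** Removing the vertex [x] costs the deletion of [x] and its link; the colon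
    ideal at [x] is the ideal of the star of [x], a cone over the link. *)
Lemma reg_step W x k : x \in W -> reg (nonface (W :\ x)) k.+1 ->
  reg (nonface (W :&: nbhd x)) k -> reg (nonface W) k.+1.
Proof.
move=> xW hd hl; apply: (koszul_reg_step (x := enum_rank x)).
- exact: nonface_ideal.
- by apply: koszul_reg_ext hd => m; rewrite nonface_var.
- apply: (@koszul_reg_ext _ _ (nonface (W :&: (x |: nbhd x)))).
    by move=> m; rewrite nonface_colon.
  have eN : (W :&: (x |: nbhd x)) :\ x = W :&: nbhd x.
    apply/setP=> y; rewrite !inE; case: eqVneq => //= ->.
    by rewrite adj_irrefl andbF.
  apply: (@reg_cone _ x); rewrite ?eN ?subsetIr //.
  by rewrite !inE xW eqxx.
Qed.

Lemma reg_clique W : clique W -> reg (nonface W) 0.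
Proof.
move: {2}#|W| (erefl #|W|) => N; elim: N W => [|N IH] W.
  by move/eqP; rewrite cards_eq0 => /eqP -> _; apply: reg_nonface0.
move=> cardW cW; have [x xW] : exists x, x \in W.
  by apply/set0Pn; rewrite -card_gt0 cardW.
apply: (reg_cone xW).
  apply/subsetP=> y; rewrite !inE => /andP[yx yW].
  by apply: (cliqueP _ cW); rewrite // eq_sym.
apply: IH (cliqueS (subD1set _ _) cW).
by move: cardW; rewrite (cardsD1 x) xW => -[].
Qed.

Definition simplicial A x := clique (A :&: nbhd x).

(** Existence of a perfect elimination order, put in hereditary form. *)
Definition simplicial_elim W := forall A, A \subset W -> A != set0 ->
  exists2 y, y \in A & simplicial A y.

Lemma simplicial_elimS A W :
  A \subset W -> simplicial_elim W -> simplicial_elim A.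
Proof. by move=> AW eW B BA; apply: eW; apply: subset_trans AW. Qed.

Lemma reg_simplicial_elim W : simplicial_elim W -> reg (nonface W) 1.
Proof.
move: {2}#|W| (erefl #|W|) => N; elim: N W => [|N IH] W.
  by move/eqP; rewrite cards_eq0 => /eqP -> _; apply: reg_nonface0.
move=> cardW eW; have [|x xW sx] := eW W (subxx _).
  by rewrite -card_gt0 cardW.
apply: (reg_step xW); last exact: reg_clique.
apply: IH (simplicial_elimS (subD1set _ _) eW).
by move: cardW; rewrite (cardsD1 x) xW => -[].
Qed.

Lemma reg_locally_simplicial W :
  (forall x, simplicial_elim (nbhd x)) -> reg (nonface W) 2.
Proof.
move=> dN; move: {2}#|W| (erefl #|W|) => N; elim: N W => [|N IH] W.
  by move/eqP; rewrite cards_eq0 => /eqP ->; apply: reg_nonface0.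
move=> cardW; have [x xW] : exists x, x \in W.
  by apply/set0Pn; rewrite -card_gt0 cardW.
apply: (reg_step xW); last first.
  exact: reg_simplicial_elim (simplicial_elimS (subsetIr _ _) (dN x)).
by apply: IH; move: cardW; rewrite (cardsD1 x) xW => -[].
Qed.

End CliqueComplex.

(** * From Koszul homology to minimal resolutions *)

Section Resolution.
Variables (K : fieldType) (n : nat).
Local Notation S := {mpoly K[n]}.

Definition kdv r (w : {set 'I_n} -> 'rV[S]_r) (B : {set 'I_n}) : 'rV[S]_r :=
  \sum_(a | a \notin B) (ksgn K a B * 'X_a) *: w (a |: B).

Lemma kdvE r (w : {set 'I_n} -> 'rV[S]_r) B j :
  kdv w B 0 j = kd (fun A => w A 0 j) B.
Proof. by rewrite /kdv summxE; apply: eq_bigr => a _; rewrite mxE. Qed.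

Lemma kdvM r s (w : {set 'I_n} -> 'rV[S]_r) (D : 'M[S]_(r, s)) B :
  kdv (fun A => w A *m D) B = kdv w B *m D.
Proof.
by rewrite /kdv mulmx_suml; apply: eq_bigr => a _; rewrite scalemxAl.
Qed.

Lemma kdvB r (w u : {set 'I_n} -> 'rV[S]_r) B :
  kdv (fun A => w A - u A) B = kdv w B - kdv u B.
Proof. by rewrite /kdv -sumrB; apply: eq_bigr => a _; rewrite scalerBr. Qed.

Lemma eq_kdv r (w u : {set 'I_n} -> 'rV[S]_r) B :
  (forall A, w A = u A) -> kdv w B = kdv u B.
Proof. by move=> h; apply: eq_bigr => a _; rewrite h. Qed.

Lemma kdv_kdv r (w : {set 'I_n} -> 'rV[S]_r) B : kdv (kdv w) B = 0.
Proof.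
apply/rowP=> j; rewrite kdvE mxE -[RHS](kd_kd (fun A => w A 0 j) B).
by apply: eq_kd => A; rewrite kdvE.
Qed.

Variables (U : pred 'X_{1..n}) (F : graded_free_complex K n).
Variable (I : S -> Prop).
Hypothesis resF : minimal_resolution I F.
Hypothesis IU : forall p, I p <-> supported U p.
Hypothesis regU : koszul_reg K U 2.
(* Exactness of the Koszul complex of the polynomial ring itself. *)
Hypothesis reg0 : @koszul_reg K n pred0 0.

(** The resolution with its augmentation included: index [0] stands for the
    polynomial ring, and index [i.+1] for the module [F_i]. *)
Definition arank (s : nat) := if s is i.+1 then rk F i else 1%N.

Definition ashift (s : nat) : 'I_(arank s) -> nat :=
  if s is i.+1 return 'I_(arank s) -> nat then @shift _ _ F i else fun=> 0%N.

Definition adiff (s : nat) : 'M[S]_(arank s.+1, arank s) :=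
  if s is i.+1 return 'M[S]_(arank s.+1, arank s) then diff F i else aug F.

Lemma row1 (v : 'rV[S]_1) : v = const_mx (v 0 0).
Proof. by apply/rowP=> j; rewrite mxE ord1. Qed.

Lemma adiff_exact s (v : 'rV[S]_(arank s.+1)) :
  v *m adiff s = 0 <-> exists w, v = w *m adiff s.+1.
Proof.
by case: s v => [|i] v; [apply: (res_exact0 resF)|apply: (res_exactS resF)].
Qed.

Lemma adiff_image0 (v : 'rV[S]_1) :
  supported U (v 0 0) <-> exists w, v = w *m adiff 0.
Proof.
split=> [/IU/(res_image resF)[w vw]|[w ->]].
  by exists w; rewrite [LHS]row1 vw -row1.
by apply/IU/(res_image resF); exists w.
Qed.

Lemma adiff_supported s a b :
  supported (deg_ge (ashift a - ashift b)) (adiff s a b).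
Proof.
have ge q d : (q : S) \is d.-homog -> supported (deg_ge d) q.
  by move=> /dhomogP h m /h /= <-; rewrite /deg_ge.
case: s a b => [|i] a b /=.
  rewrite (ord1 b) subn0; case: (aug_graded a) => [->|[_]].
    exact: supported0.
  by rewrite subn0; apply: ge.
case: (diff_graded a b) => [->|[_]]; first exact: supported0.
exact: ge.
Qed.

Lemma supported_deg0 (p : S) : p@_0%MM = 0 <-> supported (deg_ge 1) p.
Proof.
split=> [h m|h].
  rewrite mcoeff_msupp /deg_ge lt0n mdeg_eq0; apply: contraNneq => ->.
  by rewrite h.
by apply/eqP; rewrite mcoeff_eq0; apply/negP=> /h; rewrite /deg_ge mdeg0.
Qed.

Lemma supported_mulr1 (p q : S) :
  supported (deg_ge 1) q -> supported (deg_ge 1) (p * q).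
Proof.
apply: supported_mul (@supportedT _ _ _) => m m' _.
by rewrite /deg_ge mdegD => /leq_trans -> //; apply: leq_addl.
Qed.

(** Apart from the constants in exterior degree [0], Koszul cycles over the
    polynomial ring are boundaries. *)
Lemma koszul_exact p k (z : {set 'I_n} -> S) :
  level p z -> (forall A, supported (deg_ge k) (z A)) ->
  (forall A, supported (deg_ge 1) (z A)) -> (forall A, kd z A = 0) ->
  exists u, [/\ level p.+1 u, forall A, supported (deg_ge k.-1) (u A)
              & forall A, kd u A = z A].
Proof.
move=> lz dz d1 hz.
have [A|A|u [lu du eu]] := reg0 (leq0n k.-1) lz.
- by case: k dz => [|k] // _; apply: d1.
- by rewrite hz; apply: supported0.
exists u; split=> // A; apply/esym/subr0_eq/mpolyP=> m.
by rewrite mcoeff0; apply/eqP; rewrite mcoeff_eq0; apply/negP=> /eu.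
Qed.

Definition vlevel r p (w : {set 'I_n} -> 'rV[S]_r) :=
  forall A : {set 'I_n}, #|A| != p -> w A = 0.

(** Polynomial coefficients of degree at least [t] once the degrees of the basis
    elements are added; truncated subtraction puts no condition on the basis
    elements of degree above [t]. *)
Definition vorder s t (w : {set 'I_n} -> 'rV[S]_(arank s)) :=
  forall A j, supported (deg_ge (t - ashift j)) (w A 0 j).

Lemma vorder_diff s t (w : {set 'I_n} -> 'rV[S]_(arank s.+1)) A j :
  vorder t w -> supported (deg_ge (t - ashift j)) ((w A *m adiff s) 0 j).
Proof.
move=> ow; rewrite mxE; apply: supported_sum => a _.
refine (supported_mul _ (ow A a) (@adiff_supported s a j)) => m m'.
rewrite /deg_ge mdegD; lia.
Qed.

Lemma vorder_diff1 s t (w : {set 'I_n} -> 'rV[S]_(arank s.+1)) A j :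
  vorder t w -> (0 < t)%N -> supported (deg_ge 1) ((w A *m adiff s) 0 j).
Proof.
case: s w j => [|s] w j ow t0.
  refine (supportedW _ (@vorder_diff 0 t w A j ow)) => m.
  rewrite /deg_ge /=; lia.
rewrite mxE; apply: supported_sum => a _; apply: supported_mulr1.
by apply/supported_deg0/(res_minimal resF).
Qed.

(** The double complex argument.  If [w] lives over the [s]-th module, then its
    image over the previous module is a Koszul cycle, hence the boundary of a
    chain [w'] of exterior degree one more and order one less, to which
    induction applies; at [s = 0] the regularity of the ideal applies instead.
    The chain with [w' = kd u + b D] provides the solution [kd b + b' D] for
    [w], by exactness of the resolution.  The bound on [t] drops by one at each
    step, and ends at the degree [3] in which Koszul cycles bound. *)
Lemma lift_boundary s p t (w : {set 'I_n} -> 'rV[S]_(arank s))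
    (y : {set 'I_n} -> 'rV[S]_(arank s.+1)) :
  vlevel p w -> vorder t w -> (t >= s.+3)%N ->
  (forall A, kdv w A = y A *m adiff s) ->
  exists u b, forall A, w A = kdv u A + b A *m adiff s.
Proof.
elim: s p t w y => [|s IH] p t w y lw ow ts wy.
  have [||||u [_ _ eu]] := regU (k' := t.-1) (p := p) (w := fun A => w A 0 0).
  - by case: t ts {ow} => // t.
  - by move=> A Ap; rewrite lw // mxE.
  - by move=> A; have := ow A 0; rewrite subn0 prednK //; case: t ts {ow}.
  - move=> A; rewrite -kdvE wy; apply/(adiff_image0 (y A *m adiff 0)).
    by exists (y A).
  have h A : exists b, w A - kdv (fun B => const_mx (u B)) A = b *m adiff 0.
    apply/adiff_image0; rewrite !mxE kdvE.
    by rewrite (eq_kd (u := u)) // => B; rewrite mxE.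
  have [b eb] := fin_all_exists h.
  by exists (fun B => const_mx (u B)), b => A; rewrite -eb addrC subrK.
pose z A := w A *m adiff s.
have hz A : kdv z A = 0.
  by rewrite kdvM wy; apply/adiff_exact; exists (y A).
have oz A j := @vorder_diff _ _ _ A j ow.
have z1 A j : supported (deg_ge 1) (z A 0 j).
  by apply: (@vorder_diff1 _ _ _ A j ow); lia.
have h j : exists u, [/\ level p.+1 u,
    forall A, supported (deg_ge (t - ashift j).-1) (u A)
    & forall A, kd u A = z A 0 j].
  apply: (@koszul_exact p) => [A Ap|A|A|A]; [|exact: oz|exact: z1|]; last first.
    by rewrite -kdvE hz mxE.
  by rewrite /z lw // mul0mx mxE.
have [u0 eu0] := fin_all_exists h.
pose w' A := \row_j u0 j A.
have ew' A : kdv w' A = z A.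
  apply/rowP=> j; rewrite kdvE; have [_ _ <-] := eu0 j.
  by apply: eq_kd => B; rewrite mxE.
have [||//||u [b ewb]] := IH p.+1 t.-1 w' w.
- by move=> A Ap; apply/rowP=> j; rewrite !mxE; have [-> //] := eu0 j.
- move=> A j; rewrite mxE; have [_ h2 _] := eu0 j.
  by have := h2 A; rewrite -subn1 -subnDA addn1 -subn1 -subnDA add1n.
- lia.
- by [].
have h2 A : exists b', w A - kdv b A = b' *m adiff s.+1.
  apply/adiff_exact; rewrite mulmxBl -kdvM -/(z A) -ew'.
  rewrite (eq_kdv (u := fun A => kdv u A + b A *m adiff s)) //.
  rewrite (eq_kdv (w := fun A => b A *m _)
     (u := fun A => (kdv u A + b A *m adiff s) - kdv u A)).
    by rewrite kdvB kdv_kdv subr0 subrr.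
  by move=> B; rewrite addrC addKr.
have [b' eb'] := fin_all_exists h2.
by exists b, b' => A; rewrite -eb' addrC subrK.
Qed.

(** A basis element of degree above [i + 3], seen as a chain of exterior degree
    [0], would by [lift_boundary] be a combination of multiples of variables
    and of columns of the differential, whose entries have no constant term. *)
Lemma shift_le i (k : 'I_(rk F i)) : (shift k <= i + 3)%N.
Proof.
rewrite leqNgt; apply/negP=> hk.
pose w (A : {set 'I_n}) : 'rV[S]_(arank i.+1) :=
  if A == set0 then delta_mx 0 k else 0.
have [||||u [b e]] := @lift_boundary i.+1 0 (shift k) w (fun=> 0).
- by move=> A; rewrite cards_eq0 /w; case: eqP.
- move=> A j; rewrite /w; case: eqP => _; rewrite mxE; last exact: supported0.
  rewrite eqxx; case: (eqVneq j k) => [->|_]; last exact: supported0.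
  by rewrite /= subnn => m _.
- lia.
- move=> A; rewrite mul0mx; apply: big1 => a _.
  by rewrite /w setU_eq0 -cards_eq0 cards1 scaler0.
have : supported (deg_ge 1) (w set0 0 k).
  rewrite e mxE kdvE; apply: supportedD.
    apply: supported_kd (fun A => @supportedT _ _ _) => a m _.
    by rewrite /deg_ge mdegD mdeg1.
  rewrite mxE; apply: supported_sum => a _.
  apply: supported_mulr1.
  by apply/supported_deg0/(res_minimal resF).
move/supported_deg0; rewrite /w eqxx mxE !eqxx mcoeff1 eqxx.
by apply/eqP; rewrite oner_eq0.
Qed.

End Resolution.

(** * Edge ideals as ideals of clique complexes *)

Section EdgeIdeal.
Variables (K : fieldType) (G : sgraph).

Lemma edge_idealD p q :
  edge_ideal K G p -> edge_ideal K G q -> edge_ideal K G (p + q).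
Proof.
move=> [c ->] [d ->]; exists (fun xy => c xy + d xy).
by rewrite -big_split; apply: eq_bigr => xy _; rewrite /= mulrDl.
Qed.

Lemma edge_ideal_mul x y p :
  adj x y -> edge_ideal K G (p * ('X_(enum_rank x) * 'X_(enum_rank y))).
Proof.
move=> xy; exists (fun z => if z == (x, y) then p else 0).
rewrite (bigD1 (x, y)) //= eqxx big1 ?addr0 // => z /andP[_ /negbTE ->].
by rewrite mul0r.
Qed.

Lemma edge_idealE p :
  edge_ideal K G p <-> supported (@nonface (compl G) setT) p.
Proof.
split=> [[c ->]|].
  apply: supported_sum => -[x y] /= xy.
  apply: (supported_mull (@nonface_ideal (compl G) _)).
  rewrite -mpolyXD => m; rewrite msuppX inE => /eqP ->.
  apply/negP=> /andP[_ /cliqueP/(_ x y)].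
  rewrite (@msupportD (compl G)) !(@msupport1 (compl G)) !inE !eqxx orbT.
  have xNy := adj_neq xy.
  by move/(_ isT isT xNy) => /andP[_]; rewrite xy.
move=> sp; rewrite (mpolyE p) big_seq.
apply: (big_ind (edge_ideal K G)) => [|p1 p2|m /sp].
- by exists (fun=> 0); rewrite big1 // => xy _; rewrite mul0r.
- exact: edge_idealD.
rewrite /nonface subsetT /= => /cliqueP mN.
have [x [y [xm ym xy]]] : exists x, exists y : G,
    [/\ m (enum_rank x) != 0%N, m (enum_rank y) != 0%N & adj x y].
  case: (pickP [pred xy : G * G | [&& m (enum_rank xy.1) != 0%N,
      m (enum_rank xy.2) != 0%N & adj xy.1 xy.2]]) => [[x y] /and3P[]|none].
    by exists x, y.
  case: mN => x y xm ym xNy; apply/andP; split=> //; apply/negP=> xy.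
  move: (none (x, y)) xm ym; rewrite !inE /= xy andbT => /negP h xm ym.
  by apply: h; rewrite xm.
have xNy := adj_neq xy.
rewrite -(submK (m := U_(enum_rank x) + U_(enum_rank y)) (m' := m)).
  by rewrite !mpolyXD scalerAl; apply: edge_ideal_mul.
apply/mnm_lepP=> i; rewrite mnmDE !mnm1E.
case: (eqVneq (enum_rank x) i) => [<-|_];
  case: (eqVneq (enum_rank y) _) => [e|_] //=.
- by rewrite (enum_rank_inj e) eqxx in xNy.
- by rewrite lt0n.
- by rewrite -e lt0n.
Qed.

End EdgeIdeal.

Section Complete.
Variable T : finType.
Definition complete_adj : rel T := [rel x y | x != y].
Lemma complete_sym : ssrbool.symmetric complete_adj.
Proof. by move=> x y; rewrite /complete_adj /= eq_sym. Qed.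
Lemma complete_irrefl : irreflexive complete_adj.
Proof. by move=> x; rewrite /complete_adj /= eqxx. Qed.
Definition complete : sgraph := SGraph complete_sym complete_irrefl.
End Complete.

(** The zero ideal is the Stanley-Reisner ideal of a full simplex, which is the
    clique complex of a complete graph. *)
Lemma koszul_reg_pred0 (K : fieldType) (T : finType) :
  @koszul_reg K #|T| pred0 0.
Proof.
have cA (A : {set complete T}) : clique A by apply/cliqueP.
have regT := @reg_clique K (complete T) _ (cA setT).
refine (@koszul_reg_ext K #|T| _ _ _ _ regT) => m.
by rewrite /nonface subsetT cA.
Qed.

Lemma edge_ideal_reg_le3 (K : fieldType) (G : sgraph) :
  (forall x : compl G, simplicial_elim (nbhd x)) -> reg_le (edge_ideal K G) 3.
Proof.
move=> dN i j b [F resF <-] /eqP; rewrite cards_eq0 => /set0Pn[k].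
rewrite inE => /eqP <-.
have := shift_le resF (edge_idealE (G := G))
  (@reg_locally_simplicial K (compl G) setT dN) (@koszul_reg_pred0 K G) k.
lia.
Qed.

(** * Dirac's theorem on simplicial vertices of chordal graphs *)

Section Holes.
Variable H : sgraph.
Implicit Types (W V S A : {set H}) (c : seq H).

Lemma shortest_path (T : finType) (e : rel T) s t : connect e s t ->
  exists p, [/\ path e s p, last s p = t, uniq (s :: p) &
    forall q, path e s q -> last s q = t -> (size p <= size q)%N].
Proof.
pose P k := [exists p : k.-tuple T, path e s p && (last s p == t)].
move=> /connectP[p0 pp0 lp0].
have exP : exists k, P k.
  exists (size p0); apply/existsP; exists (in_tuple p0).
  by rewrite pp0 lp0 eqxx.
have [k /existsP[p /andP[pp /eqP lp]] kmin] := ex_minnP exP.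
have {}kmin q : path e s q -> last s q = t -> (k <= size q)%N.
  move=> pq lq; apply: kmin; apply/existsP; exists (in_tuple q).
  by rewrite pq lq eqxx.
case/shortenP: pp lp => p' pp' up' sub lp'.
exists p'; split=> // q pq lq; apply: leq_trans (kmin q pq lq).
by have := uniq_leq_size _ sub; rewrite size_tuple; apply; case/andP: up'.
Qed.

Definition chordless c := forall x y, x \in c -> y \in c -> adj x y ->
  y = next c x \/ x = next c y.

(** A chordless cycle of [H] inside [W] is traversed by a cycle of the nested
    induced subgraph on its vertices, which is therefore a cycle graph. *)
Lemma chordal_hole W c : chordal (induced W) -> {subset c <= W} ->
  graph_cycle c -> chordless c -> (size c < 4)%N.
Proof.
move=> chW cW [/andP[cyc unc] c3] noch.
pose W' : {set induced W} := [set y | val y \in c].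
pose f (a : induced W') : H := val (val a).
have f_inj : injective f by move=> a b /val_inj/val_inj.
have adjf a b : adj a b = adj (f a) (f b) by [].
have fonto x : x \in c -> exists a, f a = x.
  move=> xc; have xW := cW x xc.
  have xW' : (exist _ x xW : induced W) \in W' by rewrite inE.
  by exists (exist _ (exist _ x xW : induced W) xW').
have [c' ec'] : exists c' : seq (induced W'), map f c' = c.
  have : {subset c <= c} by [].
  elim: {-2}c => [|x c1 IH] sub; first by exists [::].
  have [a ea] := fonto x (sub x (mem_head _ _)).
  have [z zc1|c2 ec2] := IH; first by apply: sub; rewrite inE zc1 orbT.
  by exists (a :: c2); rewrite /= ea ec2.
have fc' a : a \in c'.
  by rewrite -(mem_map f_inj) ec'; have := valP a; rewrite inE.
have unc' : uniq c' by rewrite -(map_inj_uniq f_inj) ec'.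
have fnext a : f (next c' a) = next c (f a) by rewrite -ec' next_map.
suff : is_cycle_graph (induced W').
  move/chW; apply: leq_ltn_trans; rewrite -ec' size_map.
  rewrite -(size_map val) -(card_uniqP _); last first.
    by rewrite (map_inj_uniq val_inj).
  by apply/subset_leq_card/subsetP=> _ /mapP[a _ ->]; apply: (valP a).
exists c'; split=> //.
- split; last by rewrite -(size_map f) ec'.
  by rewrite /ucycle unc' andbT; move: cyc; rewrite -ec' cycle_map.
- apply/setP=> E; apply/imsetP/imsetP.
    move=> [[a b]]; rewrite inE => /= ab ->.
    have {}ab : adj (f a) (f b) := ab.
    have fc a0 : f a0 \in c by rewrite -ec' map_f.
    case: (noch _ _ (fc a) (fc b) ab); rewrite -fnext => /f_inj e.
      by exists a; rewrite // -e.
    by exists b; rewrite // -e setUC.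
  move=> [a _ ->]; exists (a, next c' a) => //; rewrite inE.
  change (adj (f a) (f (next c' a))); rewrite fnext.
  by apply: next_cycle cyc _; rewrite -ec' map_f.
Qed.

Lemma clique_cone A s : A :\ s \subset nbhd s -> clique (A :\ s) -> clique A.
Proof.
move=> /subsetP An /cliqueP cA; apply/cliqueP=> x y xA yA xy.
case: (eqVneq x s) xy => [-> sy|xs xy].
  by have := An y; rewrite !inE yA eq_sym sy => /(_ isT).
case: (eqVneq y s) => [->|ys].
  by have := An x; rewrite !inE xA xs adj_sym => /(_ isT).
by apply: cA; rewrite // !inE ?xs ?ys.
Qed.

Definition adj_in (R : {set H}) : rel H :=
  [rel x y | [&& adj x y, x \in R & y \in R]].

Lemma adj_in_sym R : connect_sym (adj_in R).
Proof.
by apply: sym_connect_sym => x y; rewrite /adj_in /= adj_sym [X in _ && X]andbC.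
Qed.

Lemma adj_in_path R x p : path (adj_in R) x p -> path (@adj H) x p.
Proof. by apply: sub_path => u v /and3P[]. Qed.

Lemma adj_in_pathS R x p : path (adj_in R) x p -> {subset p <= R}.
Proof.
elim: p x => //= y p IH x /andP[/and3P[_ _ yR] /IH sub] z.
by rewrite inE => /orP[/eqP ->|/sub].
Qed.

Lemma next_split (T : eqType) (s : T) p1 y p2 x :
  uniq (s :: p1 ++ y :: p2) -> last s p1 = x ->
  next (s :: p1 ++ y :: p2) x = y.
Proof.
move=> un lx; rewrite next_nth ifT; last first.
  by rewrite -lx -cat_cons mem_cat mem_last.
have -> : index x (s :: p1 ++ y :: p2) = size p1.
  rewrite -cat_cons lastI cat_rcons lx index_cat /= eqxx addn0 size_belast.
  move: un; rewrite -cat_cons lastI cat_rcons lx cat_uniq => /and3P[_ + _].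
  by rewrite /= negb_or => /andP[/negbTE -> _].
by rewrite nth_cat ltnn subnn.
Qed.

(** Two neighbours of [s] joined through a region [R] without neighbours of [s]
    are adjacent, for otherwise a shortest path between them through [R] closes
    with [s] into a chordless cycle with at least four vertices. *)
Lemma chordal_link W (R : {set H}) s z1 z2 y1 y2 : chordal (induced W) ->
  R \subset W -> s \in W -> z1 \in W -> z2 \in W ->
  (forall y, y \in R -> (y != s) && ~~ adj s y) -> adj s z1 -> adj s z2 ->
  y1 \in R -> y2 \in R -> adj y1 z1 -> adj y2 z2 -> connect (adj_in R) y1 y2 ->
  z1 != z2 -> adj z1 z2.
Proof.
move=> chW RW sW z1W z2W Rs sz1 sz2 y1R y2R yz1 yz2 y12 z12.
apply/negPn/negP=> Nz12.
pose Q := z1 |: (z2 |: R).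
have [p [pp lp up pmin]] : exists p, [/\ path (adj_in Q) z1 p, last z1 p = z2,
    uniq (z1 :: p) &
    forall q, path (adj_in Q) z1 q -> last z1 q = z2 -> (size p <= size q)%N].
  apply: shortest_path; apply: (@connect_trans _ _ y1).
    by apply: connect1; rewrite /adj_in /= adj_sym yz1 !inE y1R eqxx !orbT.
  apply: (@connect_trans _ _ y2); last first.
    by apply: connect1; rewrite /adj_in /= yz2 !inE y2R eqxx !orbT.
  apply: connect_sub y12 => u v /and3P[uv uR vR].
  by apply: connect1; rewrite /adj_in /= uv !inE uR vR !orbT.
have pQ x : x \in z1 :: p -> x \in Q.
  by rewrite inE => /orP[/eqP ->|/(adj_in_pathS pp)//]; rewrite !inE eqxx.
have sQ x : x \in Q -> adj s x -> (x == z1) || (x == z2).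
  by rewrite !inE orbA => /orP[//|/Rs/andP[_ /negbTE ->]].
have sNp : s \notin z1 :: p.
  apply/negP=> /pQ; rewrite !inE => /or3P[/eqP e|/eqP e|/Rs].
  - by rewrite e adj_irrefl in sz1.
  - by rewrite e adj_irrefl in sz2.
  - by rewrite eqxx.
have uc : uniq (s :: z1 :: p) by rewrite cons_uniq sNp.
have p2 : (2 <= size p)%N.
  case: p pp lp {up pmin pQ sNp uc} => [_ /= e|x [|y p]] //=.
    by rewrite e eqxx in z12.
  by move=> /andP[/andP[zx _] _] e; rewrite -e zx in Nz12.
have := chordal_hole (c := s :: z1 :: p) chW.
suff h : [/\ {subset s :: z1 :: p <= W}, graph_cycle (s :: z1 :: p)
    & chordless (s :: z1 :: p)].
  by case: h => h1 h2 h3 /(_ h1 h2 h3); rewrite /= !ltnS leqNgt p2.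
split.
- move=> x; rewrite inE => /orP[/eqP -> //|/pQ].
  by rewrite !inE => /or3P[/eqP ->|/eqP ->|/(subsetP RW)].
- split; last by rewrite /= !ltnS (leq_trans _ p2).
  rewrite /ucycle uc andbT /= sz1 rcons_path (adj_in_path pp) lp /=.
  by rewrite adj_sym.
(* A chord between two vertices that are not consecutive shortens the path. *)
have next_p p1 p2' x y : p = p1 ++ p2' -> last z1 p1 = x -> y \in p2' ->
    adj x y -> y = next (s :: z1 :: p) x.
  move=> ep lx yp xy; case/splitPr: yp ep => q1 q2 ep.
  suff q10 : q1 = [::].
    rewrite ep q10; apply/esym/(@next_split _ s (z1 :: p1)); last exact: lx.
    by move: uc; rewrite ep q10.
  have xQ : x \in Q by apply: pQ; rewrite ep -cat_cons mem_cat -lx mem_last.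
  have yQ : y \in Q by apply: pQ; rewrite ep !(inE, mem_cat) eqxx !orbT.
  have xyQ : adj_in Q x y by rewrite /adj_in /= xy xQ yQ.
  have := pmin (p1 ++ y :: q2); rewrite -lp ep !last_cat /=.
  move: pp; rewrite ep !cat_path lx /= xyQ => /and4P[-> _ _ ->].
  move=> /(_ isT erefl); rewrite !size_cat /= leq_add2l -{2}[(size q2).+1]add0n.
  by rewrite leq_add2r leqn0 => /nilP.
have next_s x : x \in z1 :: p -> adj s x ->
    x = next (s :: z1 :: p) s \/ s = next (s :: z1 :: p) x.
  move=> /pQ/sQ h /h /orP[/eqP ->|/eqP ->]; [left|right].
    by rewrite /= eqxx.
  case/lastP: p lp up uc {pp pmin pQ sQ sNp p2 next_p} => [|q z].
    by move=> /= e; rewrite e eqxx in z12.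
  rewrite last_rcons => <- _ uc0.
  have zc : z \in s :: z1 :: rcons q z.
    by rewrite -!rcons_cons mem_rcons mem_head.
  rewrite next_nth zc nth_default //.
  have -> : [:: s, z1 & rcons q z] = (s :: z1 :: q) ++ [:: z].
    by rewrite -cats1.
  rewrite index_cat ifN /= ?eqxx ?addn0 ?size_rcons //.
  by move: uc0; rewrite -2!rcons_cons rcons_uniq => /andP[].
move=> x y; rewrite inE => /orP[/eqP ->|xp]; rewrite inE => /orP[/eqP ->|yp].
- by rewrite adj_irrefl.
- exact: next_s.
- by rewrite adj_sym => /(next_s _ xp)[]; [right|left].
have split z q x' : x' \in z :: q ->
    exists q1 q2, q = q1 ++ q2 /\ last z q1 = x' :> H.
  by case/splitPl=> q1 q2 l; exists q1, q2.
move=> xy; have [p1 [p2' [ep lx]]] := split _ _ _ xp.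
move: yp; rewrite {1}ep -cat_cons mem_cat => /orP[|yp2]; last first.
  by left; apply: next_p ep lx yp2 xy.
case/split=> q1 [q2 [ep1 ly]]; right; rewrite adj_sym in xy.
apply: (next_p q1 (q2 ++ p2') y x) => //; first by rewrite catA -ep1.
rewrite mem_cat; move: lx; rewrite ep1 last_cat ly.
case: q2 {ep1} => [/= e|a q2 <-]; last by rewrite /= mem_last.
by rewrite e adj_irrefl in xy.
Qed.

(** Stronger than [simplicial_elim]: one vertex [x] may be excluded, which is
    what gluing graphs along an edge at [x] requires. *)
Definition dirac W := forall A x, A \subset W -> A :\ x != set0 ->
  exists2 y, y \in A :\ x & simplicial A y.

Lemma diracS A W : A \subset W -> dirac W -> dirac A.
Proof. by move=> AW dW B x BA; apply: dW; apply: subset_trans AW. Qed.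

Lemma dirac_simplicial A : dirac A -> A != set0 ->
  exists2 y, y \in A & simplicial A y.
Proof.
move=> dA; case: (pickP [pred x | x \notin A]) => [x /= xA A0|all_in].
  have eA : A :\ x = A by apply/setDidPl; rewrite disjoint_sym disjoints1.
  by have [||y] := dA A x; rewrite ?eA //; exists y.
case/set0Pn=> x xA; have [e|ne] := eqVneq (A :\ x) set0.
  exists x => //; apply/cliqueP=> y z; rewrite !inE => /andP[yA xy].
  have : y \in A :\ x by rewrite !inE yA eq_sym (adj_neq xy).
  by rewrite e inE.
by have [//||y] := dA A x; rewrite // !inE => /andP[_ yA]; exists y.
Qed.

(** Dirac's theorem in the form that its induction needs.  A vertex [s] adjacent
    to all others can be removed.  Otherwise choose [s] with [S] contained in
    its closed neighbourhood: a component [B] of the non-neighbours of [s] has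
    a clique [S'] as set of outer neighbours, and a simplicial vertex of
    [B :|: S'] outside [S'] has all its neighbours in [B :|: S']. *)
Lemma dirac_chordal W V S : chordal (induced W) -> V \subset W ->
  S \proper V -> clique S ->
  exists y, [/\ y \in V, y \notin S & simplicial V y].
Proof.
move=> chW; move: {2}#|V|.+1 (ltnSn #|V|) => N; elim: N V S => // N IH V S.
rewrite ltnS => cardV VW SV cS; have [SsubV [z zV zS]] := properP SV.
case: (pickP [pred s | (s \in V) && (V :\ s \subset nbhd s)]) => [s /=|nouniv].
  case/andP=> sV suniv.
  have [VS|] := boolP (V :\ s \subset S :\ s).
    have sS : s \notin S.
      apply: contra zS => sS; case: (eqVneq z s) => [->//|zs].
      by have /(subsetP VS) : z \in V :\ s; rewrite !inE zs // => /andP[].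
    exists s; split=> //; apply: (cliqueS (subsetIl _ _)).
    apply: (clique_cone suniv).
    exact: cliqueS (subset_trans VS (subD1set S s)) cS.
  move=> nVS; have [||||y [yV yS sy]] := IH (V :\ s) (S :\ s).
  - by move: cardV; rewrite (cardsD1 s) sV.
  - exact: subset_trans (subD1set _ _) VW.
  - by rewrite properE setSD.
  - exact: cliqueS (subD1set _ _) cS.
  move: yV yS; rewrite !inE => /andP[ys yV]; rewrite ys /= => yS.
  exists y; split=> //; apply: (@clique_cone _ s).
    by apply: subset_trans suniv; rewrite setSD // subsetIl.
  by apply: cliqueS sy; rewrite setIDAC.
have [s sV Ss] : exists2 s, s \in V & S \subset s |: nbhd s.
  have [S0|/set0Pn[s sS]] := eqVneq S set0.
    by exists z => //; rewrite S0 sub0set.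
  exists s; first exact: (subsetP SsubV).
  apply/subsetP=> y yS; rewrite !inE; case: eqVneq => //= ys.
  by apply: (cliqueP _ cS); rewrite // eq_sym.
have := nouniv s; rewrite /= sV /= => /negbT/subsetPn[b].
rewrite !inE => /andP[bs bV] sb.
pose R := V :\: (s |: nbhd s).
pose B := [set y | connect (adj_in R) b y].
have bR : b \in R by rewrite !inE negb_or bs sb.
have BR : {subset B <= R}.
  move=> y; rewrite inE => /connectP[p pp ->] {y}.
  elim/last_ind: p pp => [//|p y _]; rewrite rcons_path last_rcons.
  by case/andP=> _ /and3P[].
pose S' := [set z in V | (z \notin B) && [exists y in B, adj y z]].
have Rs y : y \in R -> (y != s) && ~~ adj s y.
  by rewrite !inE negb_or => /andP[].
have S's y : y \in S' -> adj s y.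
  rewrite !inE => /and3P[yV yB /exists_inP[x xB xy]]; have xR := BR x xB.
  apply: contraNT yB => sy; move: (xB); rewrite inE => /connect_trans; apply.
  apply: connect1; rewrite /adj_in /= xy xR !inE yV (negbTE sy) orbF andbT /=.
  by apply: contraTneq xy => ->; rewrite adj_sym; have /andP[] := Rs x xR.
have VS' : B :|: S' \subset V :\ s.
  apply/subsetP=> y; rewrite in_setU => /orP[/BR yR|yS'].
    by have := Rs y yR; move: yR; rewrite !inE => /andP[_ ->] /andP[->].
  rewrite !inE; apply/andP; split; last by move: yS'; rewrite inE => /andP[].
  by apply: contraTneq (S's y yS') => ->; rewrite adj_irrefl.
have cS' : clique S'.
  apply/cliqueP=> z1 z2 z1S z2S z12; move: (S's _ z1S) (S's _ z2S) => sz1 sz2.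
  move: z1S z2S; rewrite !inE => /and3P[z1V _ /exists_inP[y1 y1B yz1]].
  case/and3P=> z2V _ /exists_inP[y2 y2B yz2].
  apply: (@chordal_link W R s z1 z2 y1 y2) => //; try exact: BR;
    try exact: (subsetP VW).
    by apply: subset_trans VW; rewrite subsetDl.
  move: y1B y2B; rewrite !inE adj_in_sym; exact: connect_trans.
have bB : b \in B by rewrite inE.
have [|||y [yV' yS' sy]] := IH (B :|: S') S' _ _ _ cS'.
- apply: leq_ltn_trans (subset_leq_card VS') _.
  by rewrite (cardsD1 s) sV in cardV.
- exact: subset_trans VS' (subset_trans (subD1set _ _) VW).
- rewrite properE subsetUr; apply/subsetPn; exists b.
    by rewrite in_setU bB.
  by rewrite inE bB andbF.
have yB : y \in B by move: yV'; rewrite in_setU (negbTE yS') orbF.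
have yR := BR y yB; exists y; split.
- by move: yR; rewrite inE => /andP[].
- by apply/negP=> /(subsetP Ss) h; move: yR; rewrite inE h.
apply: cliqueS sy; apply/subsetP=> x; rewrite in_setI => /andP[xV yx].
rewrite in_setI yx andbT in_setU; case: (boolP (x \in B)) => //= xB.
by rewrite inE xV xB; apply/exists_inP; exists y => //; rewrite inE in yx.
Qed.

Lemma chordal_dirac W : chordal (induced W) -> dirac W.
Proof.
move=> chW A x AW Ax.
have [xA|xA] := boolP (x \in A); last first.
  have [||y [yA _ sy]] := @dirac_chordal W A set0 chW AW.
  - by rewrite proper0; apply: contraNneq Ax => ->; rewrite set0D.
  - by apply/cliqueP=> y z; rewrite inE.
  by exists y; rewrite // !inE yA andbT; apply: contraNneq xA => <-.
have [||y [yA yx sy]] := @dirac_chordal W A [set x] chW AW.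
- rewrite properE sub1set xA; apply: contra Ax.
  by rewrite -subset0 subDset setU0.
- by apply/cliqueP=> y z; rewrite !inE => /eqP -> /eqP ->; rewrite eqxx.
by exists y; rewrite // !inE yA andbT; rewrite inE in yx.
Qed.

End Holes.

(** * Neighbourhoods in chordal-cactus graphs *)

Section Cactus.
Variable H : sgraph.
Implicit Types (W A : {set H}).

Lemma clique_small A : (#|A| <= 1)%N -> clique A.
Proof.
move=> /card_le1P A1; apply/cliqueP=> x y xA yA.
by have := A1 x xA y; rewrite yA inE eq_sym => /esym ->.
Qed.

Lemma dirac_small W : (#|W| <= 2)%N -> dirac W.
Proof.
move=> W2 A x AW /set0Pn[y yAx]; exists y => //.
have yA : y \in A by move: yAx; rewrite inE => /andP[].
apply: clique_small; rewrite -ltnS.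
apply: leq_trans (_ : #|A| <= 2)%N; last first.
  exact: leq_trans (subset_leq_card AW) W2.
rewrite [leqRHS](cardsD1 y) yA ltnS; apply/subset_leq_card/subsetP=> z.
rewrite !inE => /andP[-> yz]; rewrite andbT.
by apply: contraTneq yz => ->; rewrite adj_irrefl.
Qed.

Lemma cycle_graph_dirac W v :
  is_cycle_graph (induced W) -> v \in W -> dirac (W :&: nbhd v).
Proof.
move=> [c [[/andP[_ unc] _] _ ec]] vW.
pose v' : induced W := exist _ v vW.
apply: dirac_small.
pose N := [set val (next c v'); val (prev c v')].
apply: leq_trans (_ : #|N| <= 2)%N; last first.
  by rewrite cards2; case: (_ != _).
apply/subset_leq_card/subsetP=> y; rewrite inE => /andP[yW]; rewrite inE => vy.
pose y' : induced W := exist _ y yW.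
have vy' : adj v' y' by [].
have : [set v'; y'] \in edges (induced W).
  by apply/imsetP; exists (v', y').
rewrite ec => /imsetP[x xc e].
have vNy := adj_neq vy'.
have := set21 v' y'; have := set22 v' y'; rewrite e !inE.
case/orP=> /eqP ey /orP[] /eqP ev.
- by rewrite ey ev eqxx in vNy.
- by rewrite ev prev_next // -ey eqxx orbT.
- by rewrite ev -ey eqxx.
- by rewrite ey ev eqxx in vNy.
Qed.

Lemma edge_pair (T : sgraph) (e : {set T}) u w :
  e \in edges T -> u \in e -> w \in e -> u != w -> e = [set u; w] /\ adj u w.
Proof.
case/imsetP=> -[a b]; rewrite inE /= => ab ->; rewrite !inE.
case/orP=> /eqP -> /orP[] /eqP ->; rewrite ?eqxx // => _.
by split; rewrite 1?setUC 1?adj_sym.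
Qed.

Lemma triangle_cycle (T : sgraph) (u1 u2 u3 : T) :
  adj u1 u2 -> adj u2 u3 -> adj u1 u3 ->
  graph_cycle [:: u1; u2; u3] /\
  cycle_edges [:: u1; u2; u3] = [set [set u1; u2]; [set u1; u3]; [set u2; u3]].
Proof.
move=> a12 a23 a13.
have [[n12 n23] n13] := (adj_neq a12, adj_neq a23, adj_neq a13).
split.
  split=> //; rewrite /ucycle /= a12 a23 adj_sym a13 !inE.
  by rewrite negb_or n12 n13 n23.
have [nx1 nx2 nx3] : [/\ next [:: u1; u2; u3] u1 = u2,
    next [:: u1; u2; u3] u2 = u3 & next [:: u1; u2; u3] u3 = u1].
  rewrite /= !eqxx !(eq_sym u3) (negbTE n13) (negbTE n23) eq_sym.
  by rewrite (negbTE n12).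
apply/setP=> E; rewrite !inE; apply/imsetP/idP.
  case=> x; rewrite !inE => /or3P[] /eqP -> ->.
  - by rewrite nx1 eqxx.
  - by rewrite nx2 eqxx !orbT.
  - by rewrite nx3 setUC eqxx orbT.
case/orP=> [/orP[]|] /eqP ->.
- by exists u1; rewrite ?nx1 // !inE eqxx.
- by exists u3; rewrite ?nx3 1?setUC // !inE eqxx !orbT.
- by exists u2; rewrite ?nx2 // !inE eqxx !orbT.
Qed.

Section Representation.
Variables (T : sgraph) (W : {set T} -> {set H}) (att : T -> H).
Hypothesis rep : chordal_cactus_rep W att.

Lemma edge_piece x y : adj x y ->
  exists2 e, e \in edges T & (x \in W e) /\ (y \in W e).
Proof.
move=> xy; have : [set x; y] \in edges H by apply/imsetP; exists (x, y).
rewrite (rep_edges rep) => /bigcupP[e eT]; rewrite inE => /andP[_].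
by rewrite subUset !sub1set => /andP[xe ye]; exists e.
Qed.

Lemma piece_meet e f x y : e \in edges T -> f \in edges T -> e != f ->
  x \in W e -> x \in W f -> y \in W e -> y \in W f -> x = y.
Proof.
move=> eT fT ef xe xf ye yf.
have /card_le1P/(_ x) := rep_meet rep eT fT ef.
by rewrite inE xe xf => /(_ isT)/(_ y); rewrite !inE ye yf => /esym/eqP.
Qed.

Lemma piece_glue e f x : e \in edges T -> f \in edges T -> e != f ->
  x \in W e -> x \in W f -> exists u, [/\ u \in e, u \in f & att u = x].
Proof.
move=> eT fT ef xe xf; have [|u] := rep_glue rep eT fT ef (x := x).
  by rewrite inE xe xf.
by rewrite inE => /andP[ue uf] ->; exists u.
Qed.

(** A triangle [v x y] of [H] with [v] and [x], but not [y], in the piece of [e]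
    has its edges in three different pieces; these meet pairwise in its
    vertices, so that their indices form a triangle of the skeleton. *)
Lemma bridge_triangle e v x y : e \in edges T ->
  v \in W e -> x \in W e -> y \notin W e ->
  adj v x -> adj v y -> adj x y ->
  exists u u' u'', [/\ [/\ att u = v, att u' = x & att u'' = y],
    e = [set u; u'] & [/\ adj u u', adj u' u'' & adj u u'']].
Proof.
move=> eT ve xe ye vx vy xy.
have [f fT [vf yf]] := edge_piece vy; have [g gT [xg yg]] := edge_piece xy.
have ef : e != f by apply: contraNneq ye => ->.
have eg : e != g by apply: contraNneq ye => ->.
have fg : f != g.
  apply/eqP=> fg; rewrite -fg in xg.
  by move: (adj_neq vx); rewrite (piece_meet eT fT ef ve vf xe xg) eqxx.
have [u [ue uf uv]] := piece_glue eT fT ef ve vf.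
have [u' [u'e u'g u'x]] := piece_glue eT gT eg xe xg.
have [u'' [u''f u''g u''y]] := piece_glue fT gT fg yf yg.
have attN a b : adj (att a) (att b) -> a != b.
  by move=> ab; apply: contraTneq ab => ->; rewrite adj_irrefl.
rewrite -uv -u'x -u''y in vx vy xy *.
have [-> uu'] := edge_pair eT ue u'e (attN _ _ vx).
have [_ uu''] := edge_pair fT uf u''f (attN _ _ vy).
have [_ u'u''] := edge_pair gT u'g u''g (attN _ _ xy).
by exists u, u', u''.
Qed.

(** The two triangles of the skeleton given by [bridge_triangle] share the edge
    [e], so they coincide by the cactus property; gluing points then recover
    [x] and [y] from the corners of that triangle. *)
Lemma bridge_unique e v x1 y1 x2 y2 : e \in edges T -> v \in W e ->
  x1 \in W e -> y1 \notin W e -> adj v x1 -> adj v y1 -> adj x1 y1 ->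
  x2 \in W e -> y2 \notin W e -> adj v x2 -> adj v y2 -> adj x2 y2 ->
  x1 = x2 /\ y1 = y2.
Proof.
move=> eT ve x1e y1e vx1 vy1 xy1 x2e y2e vx2 vy2 xy2.
have [u [u' [u'' [[uv u'x u''y] eE [a1 a2 a3]]]]] :=
  bridge_triangle eT ve x1e y1e vx1 vy1 xy1.
have [w [w' [w'' [[wv w'x w''y] eE' [b1 b2 b3]]]]] :=
  bridge_triangle eT ve x2e y2e vx2 vy2 xy2.
have uw : u = w.
  have : u \in e by rewrite eE set21.
  rewrite eE' !inE => /orP[/eqP //|/eqP uw'].
  by rewrite -uv uw' w'x adj_irrefl in vx2.
have uw' : u' = w'.
  have : u' \in e by rewrite eE set22.
  rewrite eE' !inE => /orP[/eqP u'w|/eqP //].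
  by rewrite -wv -u'w u'x adj_irrefl in vx1.
split; first by rewrite -u'x -w'x uw'.
rewrite -u''y -w''y; congr att; subst w w'.
have [cy1 E1] := triangle_cycle a1 a2 a3.
have [cy2 E2] := triangle_cycle b1 b2 b3.
have := rep_skeleton rep (e := e) cy1 cy2.
rewrite E1 E2 eE !inE eqxx => /(_ isT isT)/setP/(_ [set u; u'']).
rewrite !inE eqxx orbT /= => /esym.
case/orP=> [/orP[]|] /eqP/setP.
- move/(_ u''); rewrite !inE eqxx orbT => /esym/orP[] /eqP e0.
    by rewrite e0 adj_irrefl in a3.
  by rewrite e0 adj_irrefl in a2.
- move/(_ u''); rewrite !inE eqxx orbT => /esym/orP[] /eqP // e0.
  by rewrite e0 adj_irrefl in a3.
- by move/(_ u); rewrite !inE eqxx (negbTE (adj_neq a1))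
    (negbTE (adj_neq b3)).
Qed.

Lemma piece_dirac e v :
  e \in edges T -> v \in W e -> dirac (W e :&: nbhd v).
Proof.
move=> eT ve; have [cyc|ch] := rep_piece rep eT.
  exact: cycle_graph_dirac.
exact: diracS (subsetIl _ _) (chordal_dirac ch).
Qed.

(** Given [A] inside the neighbourhood of [v], take a piece that meets [A].  A
    simplicial vertex of the trace of [A] on this piece is simplicial in [A]
    unless it is the end [x] of the bridge that leaves the piece.  By [dirac]
    it can be chosen different from [x], except when the trace is [x] alone;
    then [x] has no neighbour in [A] but the other end of the bridge. *)
Lemma chordal_cactus_link (v : H) : simplicial_elim (nbhd v).
Proof.
move=> A AN /set0Pn[a aA].
have vA x : x \in A -> adj v x by move=> /(subsetP AN); rewrite inE.
have [e eT [ve ae]] := edge_piece (vA a aA).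
pose A0 := A :&: W e.
have A0d : dirac A0.
  by apply: diracS (piece_dirac eT ve); rewrite subsetI subsetIr subIset // AN.
pose bridge (p : H * H) :=
  [&& p.1 \in A0, p.2 \in A, p.2 \notin W e & adj p.1 p.2].
have lift z : z \in A0 -> (forall y, ~~ bridge (z, y)) -> simplicial A0 z ->
    exists2 y, y \in A & simplicial A y.
  move=> zA0 zb sz; exists z; first by move: zA0; rewrite inE => /andP[].
  apply: cliqueS sz; apply/subsetP=> y; rewrite !in_setI => /andP[yA zy].
  rewrite yA zy andbT /=; apply: contraNT (zb y) => ye.
  by rewrite /bridge /= zA0 yA ye; rewrite inE in zy.
case: (pickP bridge) => [[x y] /and4P[/= xA0 yA ye xy]|nobr]; last first.
  have [|z zA0 sz] := dirac_simplicial A0d.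
    by apply/set0Pn; exists a; rewrite inE aA ae.
  by apply: (lift z) => // y; rewrite nobr.
have uniq_bridge x' y' : bridge (x', y') -> x' = x /\ y' = y.
  move: xA0; rewrite /bridge /= !in_setI.
  move=> /andP[xA xe] /and4P[/andP[x'A x'e] y'A y'e x'y'].
  by apply: (bridge_unique eT ve) => //; apply: vA.
have [A0x|A0x] := eqVneq (A0 :\ x) set0; last first.
  have [z] := A0d _ _ (subxx _) A0x; rewrite !inE -in_setI => /andP[zx zA0] sz.
  apply: (lift z) => // y'; apply: contra zx => /uniq_bridge[-> _].
  exact: eqxx.
exists x; first by move: xA0; rewrite inE => /andP[].
apply: (@cliqueS _ _ [set y]); last by apply: clique_small; rewrite cards1.
apply/subsetP=> z; rewrite !inE => /andP[zA xz].
suff /uniq_bridge[_ ->] : bridge (x, z) by rewrite eqxx.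
rewrite /bridge /= xA0 zA xz andbT /=; apply/negP=> ze.
have : z \in A0 :\ x; last by rewrite A0x inE.
rewrite !inE zA ze !andbT; apply: contraTneq xz => ->.
by rewrite adj_irrefl.
Qed.

End Representation.

Lemma triangle_free_link (v : H) :
  (forall x y, adj v x -> adj v y -> ~~ adj x y) -> simplicial_elim (nbhd v).
Proof.
move=> tf A AN /set0Pn[y yA]; exists y => //.
apply: clique_small; rewrite (_ : A :&: nbhd y = set0) ?cards0 //.
apply/setP=> z; rewrite !inE; apply/negP=> /andP[zA].
have vN x : x \in A -> adj v x by move/(subsetP AN); rewrite inE.
by apply/negP; apply: tf; apply: vN.
Qed.

End Cactus.

(** * Grids *)

(** Grids are bipartite by the parity of the sum of the coordinates. *)
Lemma grid_triangle_free n m (x y z : grid n m) :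
  adj x y -> adj x z -> ~~ adj y z.
Proof.
case: x y z => [x1 x2] [y1 y2] [z1 z2]; rewrite /= /grid_adj /dist /=.
lia.
Qed.

Lemma co_grid_triangle_free G (v x y : compl G) :
  co_grid G -> adj v x -> adj v y -> ~~ adj x y.
Proof.
move=> [n [m [_ _ [f fbij fadj]]]].
have adjf a b : @adj (compl G) a b -> @adj (grid n m) (f a) (f b).
  rewrite /= /compl_adj /= -fadj /= /compl_adj /= => /andP[ab].
  by rewrite (inj_eq (bij_inj fbij)) ab negbK.
move=> /adjf vx /adjf vy; apply/negP=> /adjf.
exact/negP/grid_triangle_free/vy.
Qed.

(** * The regularity bound *)

Theorem theorem1p2 (K : fieldType) (G : sgraph)
    (hG : (co_chordal_cactus G /\ no_isolated_vertex G) \/ co_grid G) :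
  reg_le (edge_ideal K G) 3.
Proof.
apply: edge_ideal_reg_le3 => v; case: hG => [[[T [W [att rep]]] _]|gridG].
  exact: chordal_cactus_link rep v.
apply: triangle_free_link => x y vx vy; exact: co_grid_triangle_free vx vy.
Qed.
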